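(* Let $p\ge5$ be a prime with Legendre symbol $\left(\frac{-10}{p}\right)=-1$, and let $j\in\{1,2,\ldots,p-1\}$. Then for all integers $\alpha,n\ge0$, $$p_{5,5}\left(2 p^{2 \alpha+1}(p n+j)+7 \cdot \frac{p^{2 \alpha+2}-1}{12}\right) \equiv 0 \pmod 2.$$
   Context: For a partition $\lambda$, $\mathrm{mex}_{5,5}(\lambda)$ is the smallest positive multiple of $5$ that is not a part of $\lambda$; $p_{5,5}(n)$ is the number of partitions $\lambda$ of $n$ with $\mathrm{mex}_{5,5}(\lambda)\equiv 5 \pmod{10}$. *)

(* Defs.v *)
From HB Require Import structures.
From mathcomp Require Import all_boot all_order all_algebra.

Set Implicit Arguments.
Unset Strict Implicit.
Unset Printing Implicit Defensive.

Definition is_partition_of (n : nat) (s : seq nat) : bool :=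
  [&& sorted geq s, all (fun k => 0 < k) s & sumn s == n].

Lemma mex55_exists (s : seq nat) :
  exists m, [&& 0 < m, 5 %| m & m \notin s].
Proof.
exists (5 * (sumn s).+1); rewrite muln_gt0 dvdn_mulr //=.
apply/negP => hm; have hle : 5 * (sumn s).+1 <= sumn s.
  elim: s (5 * _) hm => //= x s IHs m; rewrite inE => /predU1P[-> | /IHs hm].
    exact: leq_addr.
  exact: leq_trans hm (leq_addl _ _).
by move: (leq_trans (leq_pmull _ (isT : 0 < 5)) hle); rewrite ltnn.
Qed.

Definition mex55 (s : seq nat) : nat := ex_minn (mex55_exists s).

(* A partition of n has at most n parts, each of them at most n, so the
   finite type n.-bseq 'I_n.+1 contains every partition of n. *)
Definition p55 (n : nat) : nat :=
  #|[set s : n.-bseq 'I_n.+1 |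
      is_partition_of n (map val s) && (mex55 (map val s) == 5 %[mod 10])]|.

(* The Legendre symbol (a / p), meaningful for p an odd prime. *)
Definition legendre (a : int) (p : nat) : int :=
  if (p%:Z %| a)%Z then 0%R
  else if [exists x : 'I_p, ((x%:Z ^+ 2)%R == a %[mod p%:Z])%Z] then 1%R
  else (-1)%R.

(* Main.v *)
Require Import Defs.
From mathcomp Require Import all_boot all_order all_algebra.
From mathcomp Require Import zify ring.

(** All series are over the field with two elements.  Let [f] be Euler's product
    [\prod_i (1 - X^i)], [psi = \sum_k X^(k(k+1)/2)] and [P] the generating
    function of [p55].  Since mex/5 is the number of [k >= 0] for which
    5, 10, ..., 5k are all parts, [f P = psi(X^5)].  By the pentagonal number
    theorem the coefficients of [f psi(X^5)], [psi f(X^5)] and [psi f] count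
    representations by [x^2 + 15 y^2], [3 x^2 + 5 y^2] and [3 x^2 + y^2].
    Multiplication by an element of norm 3/2 of Q(sqrt(-15)) matches the first
    two and shows that the even part of [f psi(X^5)] is [psi(X^2) f(X^10)]; an
    involution coming from Q(sqrt(-3)) shows [psi f = f^4].  Hence
    [\sum_m p55(2m) X^m = f(X^2) f(X^5)], whose coefficient of [X^m] is a number
    of representations of [24 m + 7] by [2 x^2 + 5 y^2].  In the theorem this
    number has odd [p]-adic valuation, whereas [2 x^2 + 5 y^2] is anisotropic
    modulo [p] because -10 is not a square. *)

Set Implicit Arguments.
Unset Strict Implicit.
Unset Printing Implicit Defensive.

Import GRing.Theory.

(** * Correspondences between binary quadratic forms *)

Lemma sqr_mod8 x : odd x -> x ^ 2 = 1 %[mod 8].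
Proof.
move=> ox; rewrite -modnXm; have: odd (x %% 8) by lia.
have: x %% 8 < 8 by rewrite ltn_mod.
by move: (x %% 8); do 8!case=> //.
Qed.

Lemma sqr_mod3 x : x ^ 2 %% 3 = ~~ (3 %| x).
Proof.
rewrite -modnXm /dvdn; have: x %% 3 < 3 by rewrite ltn_mod.
by case: (x %% 3) => [|[|[|]]].
Qed.

Lemma coprime6E x : coprime x 6 = odd x && ~~ (3 %| x).
Proof.
rewrite (_ : 6 = 2 * 3)%N // coprimeMr coprimen2; congr andb.
by rewrite coprime_sym prime_coprime.
Qed.

Lemma sqr_mod24 x : coprime x 6 -> x ^ 2 = 1 %[mod 24].
Proof.
rewrite coprime6E => /andP[/sqr_mod8 E8 x3].
by have := sqr_mod3 x; rewrite x3 /=; lia.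
Qed.

(** Modulo 16 the form is [x ^ 2 - y ^ 2]. Of the even numbers [x - y] and [x + y] exactly one is
    divisible by 4, so it is divisible by 8. The proof checks residues modulo 16. *)
Lemma odd_sqr_mod16 x y : odd x -> odd y -> x ^ 2 + 15 * y ^ 2 = 0 %[mod 16] ->
  x = y %[mod 8] \/ x + y = 0 %[mod 8].
Proof.
move=> ox oy.
have -> : (x ^ 2 + 15 * y ^ 2) %% 16 = ((x %% 16) ^ 2 + 15 * (y %% 16) ^ 2) %% 16.
  by rewrite -[RHS]modnDm -[in RHS]modnMmr !modnXm modnMmr modnDm.
have: odd (x %% 16) by lia. 
have: odd (y %% 16) by lia.
have Ex : x %% 16 %% 8 = x %% 8 by lia.
have Ey : y %% 16 %% 8 = y %% 8 by lia.
have Exy : (x %% 16 + y %% 16) %% 8 = (x + y) %% 8 by lia.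
rewrite -Exy -Ex -Ey.
have lx: x %% 16 < 16 by rewrite ltn_mod.
have ly: y %% 16 < 16 by rewrite ltn_mod.
move: lx ly; clear; move: (x %% 16) (y %% 16) => {}x {}y.
have H : all (fun u => all (fun v => [&& odd v, odd u & (u ^ 2 + 15 * v ^ 2) %% 16 == 0]
    ==> ((u %% 8 == v %% 8) || ((u + v) %% 8 == 0))) (iota 0 16)) (iota 0 16) by vm_compute.
move=> lx ly oy ox E; have /allP/(_ y) := allP H x ltac:(by rewrite mem_iota).
by rewrite mem_iota ly oy ox E /= => /(_ isT)/orP[]/eqP; [left|right].
Qed.

Definition absdiff m n := (m - n) + (n - m).

Definition form15 K (z : nat * nat) :=
  [&& odd z.1, odd z.2 & z.1 ^ 2 + 15 * z.2 ^ 2 == 16 * K].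
Definition form35 K (z : nat * nat) :=
  [&& odd z.1, odd z.2 & 3 * z.1 ^ 2 + 5 * z.2 ^ 2 == 8 * K].

(** The test picks the sign of [y] for which the product with [3 + s] is divisible by 4. *)
Definition form15_to_35 (z : nat * nat) :=
  if z.1 == z.2 %[mod 4] then (absdiff z.1 (5 * z.2) %/ 4, (z.1 + 3 * z.2) %/ 4)
  else ((z.1 + 5 * z.2) %/ 4, absdiff z.1 (3 * z.2) %/ 4).
(** For odd entries both signs give integers; the test picks the sign that makes both coordinates
    odd. *)
Definition form35_to_15 (z : nat * nat) :=
  if 4 %| z.1 + z.2 then ((3 * z.1 + 5 * z.2) %/ 2, absdiff z.1 z.2 %/ 2)
  else (absdiff (3 * z.1) (5 * z.2) %/ 2, (z.1 + z.2) %/ 2).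

(* Up to signs, [3a + b s = (x + y s)(3 + s)/4] with [s ^ 2 = -15]; the four
   cases are the possible signs, written without subtraction. *)
Variant linked x y a b : Prop :=
| Linked1 of x = 5 * y + 4 * a & b = a + 2 * y
| Linked2 of a + b = 2 * y & x + 3 * y = 4 * b
| Linked3 of x = 3 * y + 4 * b & a = b + 2 * y
| Linked4 of a + b = 2 * y & x + 5 * y = 4 * a.

Lemma linked_norm x y a b : linked x y a b ->
  x ^ 2 + 15 * y ^ 2 = 2 * (3 * a ^ 2 + 5 * b ^ 2).
Proof.
case=> [-> ->|E1 E2|-> ->|E1 E2]; [nia| |nia|].
  have [-> ->] : a = 2 * y - b /\ x = 4 * b - 3 * y by lia.
  by have: b <= 2 * y /\ 3 * y <= 4 * b by [lia]; nia.
have [-> ->] : b = 2 * y - a /\ x = 4 * a - 5 * y by lia.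
by have: a <= 2 * y /\ 5 * y <= 4 * a by [lia]; nia.
Qed.

Lemma linked_form15_to_35 x y a b : odd x -> odd y -> odd a -> odd b ->
  linked x y a b -> form15_to_35 (x, y) = (a, b).
Proof.
move=> ox oy oa ob; rewrite /form15_to_35 /absdiff.
case=> [Ex Eb|E1 E2|Ex Ea|E1 E2] /=.
- by rewrite ifT; [congr pair|]; lia.
- by rewrite ifT; [congr pair|]; lia.
- by rewrite ifF; [congr pair|]; lia.
- by rewrite ifF; [congr pair|]; lia.
Qed.

Lemma linked_form35_to_15 x y a b : odd x -> odd y -> odd a -> odd b ->
  linked x y a b -> form35_to_15 (a, b) = (x, y).
Proof.
move=> ox oy oa ob; rewrite /form35_to_15 /absdiff.
case=> [Ex Eb|E1 E2|Ex Ea|E1 E2] /=.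
- by rewrite ifT; [congr pair|]; lia.
- by rewrite ifF; [congr pair|]; lia.
- by rewrite ifT; [congr pair|]; lia.
- by rewrite ifF; [congr pair|]; lia.
Qed.

(** The congruence holds modulo 8, not just 4, and this makes both quotients by 4 odd. The
    comparisons fix the signs. *)
Lemma linked_exists x y : odd x -> odd y -> x = y %[mod 8] \/ x + y = 0 %[mod 8] ->
  exists a b, [/\ odd a, odd b & linked x y a b].
Proof.
move=> ox oy [E|E].
  have [le|lt] := leqP (5 * y) x.
    exists ((x - 5 * y) %/ 4), ((x + 3 * y) %/ 4).
    by split; [lia..|apply: Linked1; lia].
  exists ((5 * y - x) %/ 4), ((x + 3 * y) %/ 4).
  by split; [lia..|apply: Linked2; lia].
have [le|lt] := leqP (3 * y) x.
  exists ((x + 5 * y) %/ 4), ((x - 3 * y) %/ 4).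
  by split; [lia..|apply: Linked3; lia].
exists ((x + 5 * y) %/ 4), ((3 * y - x) %/ 4).
by split; [lia..|apply: Linked4; lia].
Qed.

Lemma linked_exists_inv a b : odd a -> odd b ->
  exists x y, [/\ odd x, odd y & linked x y a b].
Proof.
move=> oa ob; case: (boolP (4 %| a + b)) => E.
  have [le|lt] := leqP a b.
    exists ((3 * a + 5 * b) %/ 2), ((b - a) %/ 2).
    by split; [lia..|apply: Linked1; lia].
  exists ((3 * a + 5 * b) %/ 2), ((a - b) %/ 2).
  by split; [lia..|apply: Linked3; lia].
have [le|lt] := leqP (3 * a) (5 * b).
  exists ((5 * b - 3 * a) %/ 2), ((a + b) %/ 2).
  by split; [lia..|apply: Linked2; lia].
exists ((3 * a - 5 * b) %/ 2), ((a + b) %/ 2).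
by split; [lia..|apply: Linked4; lia].
Qed.

Lemma form15_to_35P K z : form15 K z ->
  form35 K (form15_to_35 z) /\ form35_to_15 (form15_to_35 z) = z.
Proof.
case: z => x y /and3P[/= ox oy /eqP E].
have xy8 : x = y %[mod 8] \/ x + y = 0 %[mod 8].
  by apply: odd_sqr_mod16 => //; rewrite E modnMr.
have [a [b [oa ob lk]]] := linked_exists ox oy xy8.
rewrite (linked_form15_to_35 _ _ _ _ lk) // (linked_form35_to_15 _ _ _ _ lk) //; split=> //.
have := linked_norm lk; rewrite E /form35 /= oa ob /=.
by move=> E2; apply/eqP; move: E2; clear; lia.
Qed.

Lemma form35_to_15P K z : form35 K z ->
  form15 K (form35_to_15 z) /\ form15_to_35 (form35_to_15 z) = z.
Proof.
case: z => a b /and3P[/= oa ob /eqP E].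
have [x [y [ox oy lk]]] := linked_exists_inv oa ob.
rewrite (linked_form35_to_15 _ _ _ _ lk) // (linked_form15_to_35 _ _ _ _ lk) //; split=> //.
have := linked_norm lk; rewrite E /form15 /= ox oy /=.
by move=> E2; apply/eqP; move: E2; clear; lia.
Qed.

Definition form3 M (z : nat * nat) :=
  [&& odd z.1, odd z.2 & 3 * z.1 ^ 2 + z.2 ^ 2 == 4 * M].
Definition form3_inv (z : nat * nat) :=
  if 4 %| z.1 + z.2 then (absdiff z.1 z.2 %/ 2, (3 * z.1 + z.2) %/ 2)
  else ((z.1 + z.2) %/ 2, absdiff (3 * z.1) z.2 %/ 2).

(* If [x, y] are odd, one of [(y +- x s)(1 + s)/4], with [s ^ 2 = -3], lies in
   [Z[s]]; conjugating there and multiplying back is [form3_inv]. *)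
Variant linked3 x y a b : Prop :=
| Linked3_1 of x = y + 2 * a & b = 2 * y + 3 * a
| Linked3_2 of y = x + 2 * a & b = 2 * x + a
| Linked3_3 of x + y = 2 * a & 3 * x = y + 2 * b
| Linked3_4 of x + y = 2 * a & y = 3 * x + 2 * b.

Lemma linked3_norm x y a b : linked3 x y a b ->
  3 * a ^ 2 + b ^ 2 = 3 * x ^ 2 + y ^ 2.
Proof.
case=> [-> ->|-> ->|E1 E2|E1 E2]; [nia|nia| |].
  have -> : y = 2 * a - x by lia.
  have -> : b = 2 * x - a by lia.
  by have: x <= 2 * a /\ a <= 2 * x by [lia]; nia.
have -> : y = 2 * a - x by lia.
have -> : b = a - 2 * x by lia.
by have: 2 * x <= a by [lia]; nia.
Qed.

Lemma linked3_form3_inv x y a b : odd x -> odd y -> odd a -> odd b ->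
  linked3 x y a b -> form3_inv (x, y) = (a, b) /\ form3_inv (a, b) = (x, y).
Proof.
move=> ox oy oa ob; rewrite /form3_inv /absdiff.
case=> [Ex Eb|E1 E2|Ex Ea|E1 E2] /=.
- by rewrite ifT 1?ifF; [split; congr pair|..]; lia.
- by rewrite ifT 1?ifT; [split; congr pair|..]; lia.
- by rewrite ifF 1?ifF; [split; congr pair|..]; lia.
- by rewrite ifF 1?ifT; [split; congr pair|..]; lia.
Qed.

Lemma linked3_exists x y : odd x -> odd y ->
  exists a b, [/\ odd a, odd b & linked3 x y a b].
Proof.
move=> ox oy; case: (boolP (4 %| x + y)) => E.
  have [le|lt] := leqP y x.
    exists ((x - y) %/ 2), ((3 * x + y) %/ 2).
    by split; [lia..|apply: Linked3_1; lia].
  exists ((y - x) %/ 2), ((3 * x + y) %/ 2).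
  by split; [lia..|apply: Linked3_2; lia].
have [le|lt] := leqP y (3 * x).
  exists ((x + y) %/ 2), ((3 * x - y) %/ 2).
  by split; [lia..|apply: Linked3_3; lia].
exists ((x + y) %/ 2), ((y - 3 * x) %/ 2).
by split; [lia..|apply: Linked3_4; lia].
Qed.

Lemma form3_invP M z : form3 M z -> form3 M (form3_inv z) /\ form3_inv (form3_inv z) = z.
Proof.
case: z => x y /and3P[/= ox oy /eqP E].
have [a [b [oa ob lk]]] := linked3_exists ox oy.
have [-> ->] := linked3_form3_inv ox oy oa ob lk; split=> //.
by rewrite /form3 /= oa ob (linked3_norm lk) E /=.
Qed.

(** The points with [z.2 = 3 * z.1] disappear once [z.2] is prime to 6, and only the diagonal
    remains. *)
Lemma form3_inv_fix M z : form3 M z -> (form3_inv z == z) = (z.1 == z.2) || (z.2 == 3 * z.1).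
Proof.
case: z => a b /and3P[/= oa ob _]; rewrite /form3_inv /absdiff /=.
by case: ifP => ab; rewrite -pair_eqE /=; lia.
Qed.

(** * Counting representations *)

Lemma count_leq_can (T : eqType) (s : seq T) (R S : pred T) (f g : T -> T) :
  uniq s -> (forall x, R x -> S (f x) /\ g (f x) = x) ->
  (forall x, S x -> x \in s) -> count R s <= count S s.
Proof.
move=> us fP Ss; rewrite -!size_filter -(size_map f).
apply: uniq_leq_size.
  rewrite map_inj_in_uniq ?filter_uniq // => x y; rewrite !mem_filter.
  by move=> /andP[/fP[_ fx] _] /andP[/fP[_ fy] _] E; rewrite -fx E fy.
move=> y /mapP[x]; rewrite mem_filter => /andP[/fP[Sfx _] _] ->.
by rewrite mem_filter Sfx Ss.
Qed.

(** Points that are not fixed pair off as [x], [f x]; the induction removes a fixed point or such a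
    pair. *)
Lemma odd_size_involution (T : eqType) (s : seq T) (f : T -> T) :
  uniq s -> {in s, forall x, f x \in s} -> {in s, cancel f f} ->
  odd (size s) = odd (count (fun x => f x == x) s).
Proof.
have [n] := ubnP (size s); elim: n s => // n IH [|x s] //= ltn /andP[xs us] fs fK.
have [fx|fx] := eqVneq (f x) x.
  rewrite add1n /= (IH s) // => y ys.
    have := fs y; rewrite !inE ys orbT => /(_ isT) /predU1P[fy|//].
    by have := fK y; rewrite inE ys orbT fy fx => /(_ isT) xy; rewrite xy ys in xs.
  by apply: fK; rewrite inE ys orbT.
have fxs : f x \in s by have := fs x (mem_head _ _); rewrite inE (negPf fx).
have ffx : f (f x) = x by apply: fK; rewrite mem_head.
rewrite add0n (perm_size (perm_to_rem fxs)) (permP (perm_to_rem fxs)) /=.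
rewrite ffx eq_sym (negPf fx) add0n negbK; apply: IH; rewrite ?rem_uniq //.
- by move: ltn; rewrite (perm_size (perm_to_rem fxs)) /=; lia.
- move=> y; rewrite !mem_rem_uniq // !inE => /andP[yfx ys].
  have ys' : y \in x :: s by rewrite inE ys orbT.
  have := fs y ys'; rewrite inE => /predU1P[fy|->].
    by rewrite -fy (fK y ys') eqxx in yfx.
  rewrite andbT; apply: contraNneq xs => E.
  by rewrite -ffx -E (fK y ys').
- by move=> y /mem_rem ys; apply: fK; rewrite inE ys orbT.
Qed.

Definition grid B := [seq (x, y) | x <- index_iota 0 B, y <- index_iota 0 B].

Lemma grid_uniq B : uniq (grid B).
Proof. by apply: allpairs_uniq; rewrite ?iota_uniq // => -[? ?] [? ?]. Qed.

Lemma mem_grid B z : (z \in grid B) = (z.1 < B) && (z.2 < B).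
Proof.
case: z => x y; apply/allpairsP/andP => [[[u v] []]|[lx ly]].
  by rewrite !mem_index_iota /= => lu lv [-> ->].
by exists (x, y); rewrite !mem_index_iota.
Qed.

Lemma count_mul_grid B (P Q : pred nat) (R : rel nat) :
  \sum_(0 <= x < B | P x) \sum_(0 <= y < B | Q y) R x y =
  count (fun z => [&& P z.1, Q z.2 & R z.1 z.2]) (grid B).
Proof.
rewrite -sum1_count [RHS]big_mkcond big_allpairs [LHS]big_mkcond.
apply: eq_bigr => x _; case: (P x) => /=; last by rewrite big1.
by rewrite big_mkcond; apply: eq_bigr => y _; case: (Q y); case: (R x y).
Qed.

Local Open Scope ring_scope.

Lemma natr_F2 n : n%:R = (odd n)%:R :> 'F_2.
Proof.
rewrite -{1}(odd_double_half n) natrD -mul2n natrM.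
by rewrite (_ : 2%:R = 0 :> 'F_2) ?mul0r ?addr0 //; apply/val_inj.
Qed.

Lemma natr_F2_eq0 n : (n%:R == 0 :> 'F_2) = ~~ odd n.
Proof. by rewrite natr_F2; case: (odd n). Qed.

Lemma coef_sum_Xn (B : nat) (P : pred nat) (e : nat -> nat) i :
  (\sum_(0 <= x < B | P x) 'X^(e x) : {poly 'F_2})`_i =
  (count (fun x => P x && (e x == i)) (index_iota 0 B))%:R.
Proof.
rewrite coef_sum -sum1_count natr_sum big_mkcondr.
by apply: eq_bigr => x _; rewrite coefXn eq_sym; case: eqP.
Qed.

Lemma coefM_sum_Xn (B : nat) (P Q : pred nat) (e f : nat -> nat) i :
  ((\sum_(0 <= x < B | P x) 'X^(e x)) * (\sum_(0 <= y < B | Q y) 'X^(f y))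
    : {poly 'F_2})`_i =
  (count (fun z => [&& P z.1, Q z.2 & (e z.1 + f z.2 == i)%N]) (grid B))%:R.
Proof.
rewrite big_distrlr /= coef_sum.
rewrite -(count_mul_grid B P Q (fun x y => e x + f y == i)%N) natr_sum.
apply: eq_bigr => x _; rewrite coef_sum natr_sum.
by apply: eq_bigr => y _; rewrite -exprD coefXn eq_sym.
Qed.

(* Truncations of [\sum_k X^(c k(3k-1)/2)] over integers [k], and of
   [\sum_k X^(c k(k+1)/2)] over naturals [k], indexed by [x = |6k-1|] and
   [x = 2k+1]: then [x ^ 2 %/ 24] and [x ^ 2 %/ 8] are [(x^2-1)/24] and
   [(x^2-1)/8]. *)
Definition euler_theta B c : {poly 'F_2} :=
  \sum_(0 <= x < B | coprime x 6) 'X^(c * (x ^ 2 %/ 24))%N.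
Definition gauss_theta B c : {poly 'F_2} :=
  \sum_(0 <= x < B | odd x) 'X^(c * (x ^ 2 %/ 8))%N.

Local Close Scope ring_scope.

Lemma sqr_ge x : x <= x ^ 2.
Proof. by case: x => // x; rewrite expnS leq_pmulr ?expn_gt0. Qed.

(** The exponent equation times 24 reads [x ^ 2 + 15 * y ^ 2 = 48 * i + 16]. Conversely, this value
    is 1 modulo 3, so 3 cannot divide [x]. The next two lemmas work in the same way. *)
Lemma euler_gauss_form15 i x y :
  [&& coprime x 6, odd y & 1 * (x ^ 2 %/ 24) + 5 * (y ^ 2 %/ 8) == i.*2]
  = form15 (3 * i + 1) (x, y).
Proof.
rewrite coprime6E /form15 /=; apply/and3P/and3P.
  case=> /andP[ox x3] oy E; have := sqr_mod8 oy.
  have: x ^ 2 = 1 %[mod 24] by apply: sqr_mod24; rewrite coprime6E ox.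
  by split=> //; lia.
case=> ox oy E; have x3 : ~~ (3 %| x).
  by have := sqr_mod3 x; case: (3 %| x) => //=; lia.
have := sqr_mod8 oy; have: x ^ 2 = 1 %[mod 24] by apply: sqr_mod24; rewrite coprime6E ox.
by rewrite ox x3; split=> //; lia.
Qed.

Lemma gauss_euler_form35 i x y :
  [&& odd x, coprime y 6 & 1 * (x ^ 2 %/ 8) + 5 * (y ^ 2 %/ 24) == i]
  = form35 (3 * i + 1) (x, y).
Proof.
rewrite coprime6E /form35 /=; apply/and3P/and3P.
  case=> ox /andP[oy y3] E; have := sqr_mod8 ox.
  have: y ^ 2 = 1 %[mod 24] by apply: sqr_mod24; rewrite coprime6E oy.
  by split=> //; lia.
case=> ox oy E; have y3 : ~~ (3 %| y).
  by have := sqr_mod3 y; case: (3 %| y) => //=; lia.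
have := sqr_mod8 ox; have: y ^ 2 = 1 %[mod 24] by apply: sqr_mod24; rewrite coprime6E oy.
by rewrite oy y3; split=> //; lia.
Qed.

Lemma gauss_euler_form3 i x y :
  [&& odd x, coprime y 6 & 1 * (x ^ 2 %/ 8) + 1 * (y ^ 2 %/ 24) == i]
  = form3 (6 * i + 1) (x, y).
Proof.
rewrite coprime6E /form3 /=; apply/and3P/and3P.
  case=> ox /andP[oy y3] E; have := sqr_mod8 ox.
  have: y ^ 2 = 1 %[mod 24] by apply: sqr_mod24; rewrite coprime6E oy.
  by split=> //; lia.
case=> ox oy E; have y3 : ~~ (3 %| y).
  by have := sqr_mod3 y; case: (3 %| y) => //=; lia.
have := sqr_mod8 ox; have: y ^ 2 = 1 %[mod 24] by apply: sqr_mod24; rewrite coprime6E oy.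
by rewrite oy y3; split=> //; lia.
Qed.

Local Open Scope ring_scope.

(** The correspondence between [form15] and [form35] is used in both directions. As [x <= x ^ 2],
    the bound on [B] puts all solutions into the grid. *)
Lemma even_euler_gauss_theta B i : (48 * i + 16 < B)%N ->
  (euler_theta B 1 * gauss_theta B 5)`_i.*2 = (gauss_theta B 1 * euler_theta B 5)`_i.
Proof.
move=> ltB; rewrite !coefM_sum_Xn; congr (_%:R).
rewrite (eq_count (a2 := form15 (3 * i + 1))); last first.
  by case=> x y; rewrite euler_gauss_form15.
rewrite [RHS](eq_count (a2 := form35 (3 * i + 1))); last first.
  by case=> x y; rewrite gauss_euler_form35.
apply/eqP; rewrite eqn_leq; apply/andP; split.
  apply: count_leq_can (grid_uniq B) (@form15_to_35P _) _ => -[x y] /and3P[_ _ /eqP /= E].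
  by rewrite mem_grid /=; have := sqr_ge x; have := sqr_ge y; lia.
apply: count_leq_can (grid_uniq B) (@form35_to_15P _) _ => -[x y] /and3P[_ _ /eqP /= E].
by rewrite mem_grid /=; have := sqr_ge x; have := sqr_ge y; lia.
Qed.

(** Modulo 2 only the fixed points of [form3_inv] count. These are the pairs [(u, u)] with
    [u ^ 2 = 6 * i + 1], which index the terms of degree [i] on the right. *)
Lemma gauss_mul_euler_theta B i : (24 * i + 4 < B)%N ->
  (gauss_theta B 1 * euler_theta B 1)`_i = (euler_theta B 4)`_i.
Proof.
move=> ltB; rewrite coefM_sum_Xn coef_sum_Xn natr_F2 [RHS]natr_F2; congr ((nat_of_bool _)%:R).
rewrite (eq_count (a2 := form3 (6 * i + 1))); last first.
  by case=> x y; rewrite gauss_euler_form3.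
rewrite -size_filter (@odd_size_involution _ _ form3_inv) ?filter_uniq ?grid_uniq //.
- congr odd; rewrite count_filter -!size_filter.
  rewrite -[RHS](size_map (fun x => (x, x))).
  apply: perm_size; apply: uniq_perm.
  + by rewrite filter_uniq ?grid_uniq.
  + by rewrite map_inj_uniq ?filter_uniq ?iota_uniq // => x y [].
  case=> x y; rewrite mem_filter mem_grid /=.
  apply/andP/mapP => [[/andP[Ef R] /andP[lx ly]]|[u]].
    rewrite (form3_inv_fix R) /= in Ef.
    have := R; rewrite -gauss_euler_form3 => /and3P[ox cy E].
    have {Ef} /eqP Exy : x == y.
      case/orP: Ef => // /eqP Ey; move: cy; rewrite coprime6E Ey.
      by rewrite dvdn_mulr // andbF.
    exists y; last by rewrite Exy.
    rewrite mem_filter mem_index_iota cy ly /= andbT.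
    by have := sqr_mod24 cy; move: E; rewrite Exy; lia.
  rewrite mem_filter mem_index_iota => /andP[/andP[cu E] lu] [-> ->].
  rewrite /= in lu; rewrite lu; split=> //.
  have R : form3 (6 * i + 1) (u, u).
    rewrite -gauss_euler_form3 cu; move: (cu); rewrite coprime6E => /andP[-> _] /=.
    by have := sqr_mod24 cu; move: E; lia.
  by rewrite (form3_inv_fix R) R /= eqxx.
- move=> z; rewrite !mem_filter => /andP[/form3_invP[R _] _]; rewrite R /= mem_grid.
  case: (form3_inv z) R => x y /and3P[_ _ /eqP /= E].
  by have := sqr_ge x; have := sqr_ge y; lia.
- by move=> z; rewrite mem_filter => /andP[/form3_invP[_ ?] _].
Qed.

Lemma euler_theta_2_5 B m : (forall x y, (2 * x ^ 2 + 5 * y ^ 2 != 24 * m + 7)%N) ->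
  (euler_theta B 2 * euler_theta B 5)`_m = 0.
Proof.
move=> nrep; rewrite coefM_sum_Xn (eq_count (a2 := pred0)) ?count_pred0 // => -[x y] /=.
apply/negP => /and3P[/sqr_mod24 cx /sqr_mod24 cy /eqP E].
by have /eqP := nrep x y; apply; lia.
Qed.

(** * Power series modulo a power of X *)

Lemma addF2 (x : 'F_2) : x + x = 0.
Proof. by rewrite -mulr2n -mulr_natl (_ : 2%:R = 0) ?mul0r //; apply/val_inj. Qed.

Lemma addF2_poly (p : {poly 'F_2}) : p + p = 0.
Proof. by apply/polyP => i; rewrite coefD coef0 addF2. Qed.

Lemma sqr_F2_poly (p : {poly 'F_2}) : p ^+ 2 = p \Po 'X^2.
Proof.
elim/poly_ind: p => [|p c IH]; first by rewrite expr0n comp_poly0.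
rewrite comp_polyD comp_polyM comp_polyX comp_polyC -IH sqrrD mulr2n addF2_poly addr0.
rewrite exprMn -polyC_exp; congr (_ + _%:P).
by case: c => [[|[|]]] // lt; apply/val_inj.
Qed.

Definition eqX (N : nat) (p q : {poly 'F_2}) := forall i, (i < N)%N -> p`_i = q`_i.

Lemma eqX_refl N p : eqX N p p. Proof. by []. Qed.

Lemma eqX_sym N p q : eqX N p q -> eqX N q p.
Proof. by move=> E i /E. Qed.

Lemma eqX_trans N q p r : eqX N p q -> eqX N q r -> eqX N p r.
Proof. by move=> E1 E2 i lti; rewrite E1 // E2. Qed.

Lemma eqX_le M N p q : (M <= N)%N -> eqX N p q -> eqX M p q.
Proof. by move=> le E i lti; apply: E; apply: leq_trans le. Qed.

Lemma eqX_mul N p p' q q' : eqX N p p' -> eqX N q q' -> eqX N (p * q) (p' * q').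
Proof.
move=> E1 E2 i lti; rewrite !coefM; apply: eq_bigr => j _.
rewrite E1 ?E2 //; [exact: leq_ltn_trans (leq_subr _ _) lti|].
by apply: leq_ltn_trans lti; rewrite -ltnS.
Qed.

Lemma eqX_prod N (I : Type) (r : seq I) (F G : I -> {poly 'F_2}) :
  (forall i, eqX N (F i) (G i)) -> eqX N (\prod_(i <- r) F i) (\prod_(i <- r) G i).
Proof. by move=> E; elim/big_rec2: _ => // i p q _ E2; apply: eqX_mul. Qed.

Lemma eqX_addXn N e p q : (N <= e)%N -> eqX N (p + q * 'X^e) p.
Proof. by move=> le i lti; rewrite coefD coefMXn (leq_trans lti le) addr0. Qed.

Lemma eqX_cancel N (u p q : {poly 'F_2}) : u`_0 = 1 -> eqX N (u * p) (u * q) -> eqX N p q.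
Proof.
move=> u0 E i; elim/ltn_ind: i => i IH lti.
have := E i lti; rewrite !coefM !big_ord_recl /= u0 !mul1r subn0.
rewrite [X in _ = _ + X](_ : _ = \sum_(j < i) u`_(bump 0 j) * p`_(i - bump 0 j)).
  exact: addIr.
apply: eq_bigr => j _; rewrite IH //; rewrite /bump; have := ltn_ord j; lia.
Qed.

Lemma eqX_sum_trunc N A B (P : pred nat) (e : nat -> nat) : (A <= B)%N ->
  (forall x, (A <= x)%N -> P x -> (N <= e x)%N) ->
  eqX N (\sum_(0 <= x < B | P x) 'X^(e x)) (\sum_(0 <= x < A | P x) 'X^(e x)).
Proof.
move=> leAB le i lti; rewrite (big_cat_nat (leq0n A) leAB) //= coefD.
rewrite [X in _ + X](_ : _ = 0) ?addr0 //.
rewrite coef_sum big_nat_cond big1 // => x /andP[/andP[leAx _] Px].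
by rewrite coefXn; case: eqP => // Ei; have := le x leAx Px; rewrite -Ei leqNgt lti.
Qed.

(** * Euler's pentagonal number theorem modulo 2 *)

Definition euler_prod s n : {poly 'F_2} := \prod_(s <= i < n) (1 + 'X^(i.+1)).
(* The finite sums of D. Shanks' proof of the pentagonal number theorem; their
   first term is the Euler product and the others vanish modulo [X^(n+1)]. *)
Definition shanks n : {poly 'F_2} :=
  \sum_(0 <= s < n.+1) euler_prod s n * 'X^(s * n + 'C(s.+1, 2)).

(** For [s <= n] the new term splits as [a s + a s * (1 + 'X^s) + b s], and
    [a s.+1 * (1 + 'X^(s.+1)) = b s]. In characteristic 2 the last two sums cancel up to [b n],
    which with the term [s = n.+1] gives the two new pentagonal powers. *)
Lemma shanks_rec n : shanks n.+1 =
  shanks n + ('X^(n.+1 ^ 2 + 'C(n.+1, 2)) + 'X^(n.+1 ^ 2 + 'C(n.+2, 2))).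
Proof.
pose a s : {poly 'F_2} := euler_prod s n * 'X^(s * n + 'C(s.+1, 2)).
pose b s : {poly 'F_2} := euler_prod s n * 'X^(s.+1 * n.+1 + 'C(s.+1, 2)).
have Eb s : (s < n)%N -> a s.+1 * (1 + 'X^(s.+1)) = b s.
  move=> lt; rewrite /a /b mulrAC; congr (_ * _).
    by rewrite /euler_prod [in RHS]big_ltn // mulrC.
  congr ('X^_); rewrite (binS s.+1) bin1; lia.
have Ea s : (s < n.+1)%N ->
    euler_prod s n.+1 * 'X^(s * n.+1 + 'C(s.+1, 2)) = a s + a s * (1 + 'X^s) + b s.
  move=> lt; have -> : a s + a s * (1 + 'X^s) = a s * 'X^s.
    by rewrite mulrDr mulr1 addrA addF2_poly add0r.
  rewrite /euler_prod big_nat_recr //= -/(euler_prod s n) mulrDr mulr1 mulrDl.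
  rewrite /a /b; congr (_ + _).
    by rewrite -mulrA -exprD; congr (_ * 'X^_); lia.
  by rewrite -mulrA -exprD; congr (_ * 'X^_); lia.
rewrite {1}/shanks big_nat_recr //= [euler_prod n.+1 _]big_geq // mul1r.
rewrite (eq_big_nat _ _ (F2 := fun s => a s + a s * (1 + 'X^s) + b s)); last first.
  by move=> s /andP[_ /Ea].
rewrite !big_split /= -/(shanks n) [X in _ + X + _]big_nat_recl //.
rewrite expr0 addF2_poly mulr0 add0r [X in _ + X + _ + _](eq_big_nat _ _ (F2 := b)); last first.
  by move=> s /andP[_ /Eb].
rewrite [X in _ + X + _]big_nat_recr //= /b [euler_prod n n]big_geq // mul1r.
rewrite -!addrA; congr (_ + _); rewrite !addrA addF2_poly add0r.
by congr ('X^_ + 'X^_); rewrite mulnn.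
Qed.

Lemma shanks_euler_theta n : shanks n = euler_theta (6 * n + 2) 1.
Proof.
elim: n => [|n IH].
  rewrite /shanks /euler_theta big_nat1 /euler_prod big_geq // mul1r.
  rewrite muln0 add0n big_mkcond big_nat_recr // big_nat1.
  have -> : coprime 0 6 = false by [].
  have -> : coprime 1 6 = true by [].
  by rewrite /= add0r.
rewrite shanks_rec IH /euler_theta big_mkcond [RHS]big_mkcond.
have -> : (6 * n.+1 + 2 = (6 * n + 2).+4.+2)%N by lia.
rewrite !(big_nat_recr _ _ _ (leq0n _)) /= -!addrA; congr (_ + _).
(* Of the six new indices only [6 * n + 5] and [6 * n + 7] are prime to 6; their squares yield the
   two new exponents. *)
have c0 : coprime (6 * n + 2) 6 = false by rewrite coprime6E; lia.
have c1 : coprime (6 * n + 2).+1 6 = false by rewrite coprime6E; lia.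
have c2 : coprime (6 * n + 2).+2 6 = false by rewrite coprime6E; lia.
have c3 : coprime (6 * n + 2).+3 6 = true by rewrite coprime6E; lia.
have c4 : coprime (6 * n + 2).+4 6 = false by rewrite coprime6E; lia.
have c5 : coprime (6 * n + 2).+4.+1 6 = true by rewrite coprime6E; lia.
rewrite c0 c1 c2 c3 c4 c5 !add0r.
have C1 : ('C(n.+1, 2) * 2 = n * n.+1)%N by have := mul_bin_diag n.+1 1; rewrite /= bin1; lia.
have C2 : 'C(n.+2, 2) = ('C(n.+1, 2) + n.+1)%N by rewrite binS bin1.
have E1 : ((6 * n + 2).+3 ^ 2 = (n.+1 ^ 2 + 'C(n.+1, 2)) * 24 + 1)%N by nia.
have E2 : ((6 * n + 2).+4.+1 ^ 2 = (n.+1 ^ 2 + 'C(n.+2, 2)) * 24 + 1)%N by nia.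
by rewrite !mul1n E1 E2 !divnMDl // !addn0.
Qed.

Lemma euler_prod_shanks n : eqX n.+1 (euler_prod 0 n) (shanks n).
Proof.
move=> i lti; rewrite /shanks big_nat_recl // mul0n expr0 mulr1 coefD.
rewrite [X in _ + X](_ : _ = 0) ?addr0 // coef_sum big1 // => s _.
rewrite coefMXn ifT //; apply: leq_trans lti _.
by rewrite binS bin1; lia.
Qed.

Lemma euler_prod_coef0 n : (euler_prod 0 n)`_0 = 1.
Proof.
rewrite -horner_coef0 horner_prod big1 // => i _.
by rewrite hornerD hornerC hornerXn expr0n addr0.
Qed.

Lemma euler_prod_trunc n n' : (n <= n')%N -> eqX n.+1 (euler_prod 0 n') (euler_prod 0 n).
Proof.
move=> le; rewrite {1}/euler_prod (big_cat_nat (leq0n n) le) //= -/(euler_prod 0 n).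
rewrite -[X in eqX _ _ X]mulr1; apply: eqX_mul => //.
rewrite big_nat_cond; elim/big_rec: _ => // i p /andP[/andP[lei _] _] E.
rewrite -[1 in X in eqX _ _ X]mul1r; apply: eqX_mul E.
by rewrite -['X^_]mul1r; apply: eqX_addXn.
Qed.

Lemma euler_theta_comp B c : euler_theta B c = euler_theta B 1 \Po 'X^c.
Proof.
rewrite /euler_theta raddf_sum; apply: eq_bigr => x _.
by rewrite /= comp_Xn_poly -exprM mul1n.
Qed.

Lemma euler_theta_prod n : eqX n.+1 (euler_theta (6 * n + 2) 1) (euler_prod 0 n).
Proof. by rewrite -shanks_euler_theta; apply/eqX_sym/euler_prod_shanks. Qed.

(** * Even part of the quotient of theta series *)

Lemma even_poly_comp (p q : {poly 'F_2}) :
  even_poly ((p \Po 'X^2) * q) = p * even_poly q.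
Proof.
elim/poly_ind: p => [|p c IH]; first by rewrite comp_poly0 !mul0r raddf0.
rewrite comp_polyD comp_polyM comp_polyX comp_polyC !mulrDl even_polyD.
rewrite !mul_polyC even_polyZ; congr (_ + _).
rewrite mulrAC expr2 mulrA even_polyMX odd_polyMX IH; ring.
Qed.

Lemma eqX_even_poly m p q : eqX m.*2.+1 p q -> eqX m.+1 (even_poly p) (even_poly q).
Proof. by move=> E i lti; rewrite !coef_even_poly E //; lia. Qed.

(* With [T] the theta series of Euler's product, [T^2] is even, so taking even
   parts in [T^2 G = T psi(X^5)] gives [T G_even = psi T(X^5)]; a further factor
   [T] turns [psi T] into [T(X^4) = T^4], and [T^2] cancels. *)
Lemma even_part_quotient m n0 (G : {poly 'F_2}) (B := (6 * n0 + 2)%N) :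
  (48 * m + 16 < B)%N ->
  eqX m.*2.+1 (euler_theta B 1 * G) (gauss_theta B 5) ->
  G`_m.*2 = (euler_theta B 2 * euler_theta B 5)`_m.
Proof.
move=> ltB; set T := euler_theta B 1 => EG.
have T0 : T`_0 = 1 by rewrite euler_theta_prod ?euler_prod_coef0.
have E1 : eqX m.+1 (T * even_poly G) (gauss_theta B 1 * euler_theta B 5).
  rewrite -even_poly_comp -sqr_F2_poly expr2 -mulrA.
  apply: (@eqX_trans _ (even_poly (T * gauss_theta B 5))).
    by apply: eqX_even_poly; apply: eqX_mul EG.
  by move=> i lti; rewrite coef_even_poly even_euler_gauss_theta //; lia.
have E2 : eqX m.+1 (gauss_theta B 1 * T) (euler_theta B 4).
  by move=> i lti; rewrite gauss_mul_euler_theta //; lia.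
have E4 : euler_theta B 4 = T ^+ 2 * T ^+ 2.
  rewrite euler_theta_comp -/T (sqr_F2_poly T) -expr2 (sqr_F2_poly (T \Po _)).
  by rewrite -comp_polyA comp_Xn_poly -exprM.
rewrite -coef_even_poly; apply: (@eqX_cancel m.+1 (T ^+ 2)) (ltnSn m).
  by rewrite expr2 coefM big_ord1 T0 mulr1.
rewrite (euler_theta_comp B 2) -/T -sqr_F2_poly mulrA -E4 expr2 -mulrA.
apply: eqX_trans (eqX_mul (@eqX_refl _ T) E1) _.
by rewrite mulrA [T * _]mulrC; apply: eqX_mul.
Qed.

Lemma gauss_theta_bin K c :
  gauss_theta (2 * K) c = \sum_(0 <= k < K) 'X^(c * 'C(k.+1, 2)).
Proof.
elim: K => [|K IH]; first by rewrite /gauss_theta !big_geq.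
rewrite big_nat_recr //= -IH /gauss_theta big_mkcond [in RHS]big_mkcond.
have -> : (2 * K.+1 = (2 * K).+2)%N by lia.
rewrite !(big_nat_recr _ _ _ (leq0n _)) /= oddM /= addr0; congr (_ + 'X^(_ * _)).
have C1 : ('C(K.+1, 2) * 2 = K * K.+1)%N by have := mul_bin_diag K.+1 1; rewrite /= bin1; lia.
have -> : ((2 * K).+1 ^ 2 = 'C(K.+1, 2) * 8 + 1)%N by nia.
by rewrite divnMDl // addn0.
Qed.

Lemma even_quotient_euler_prod m (G : {poly 'F_2}) :
  eqX m.*2.+1 (euler_prod 0 m.*2 * G) (\sum_(0 <= k < (m.*2 %/ 5).+1) 'X^(5 * 'C(k.+1, 2))) ->
  (forall x y, (2 * x ^ 2 + 5 * y ^ 2 != 24 * m + 7)%N) ->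
  G`_m.*2 = 0.
Proof.
(* This makes the truncation bound [6 * n0 + 2 = 48 * m + 50], above the required [48 * m + 16]. *)
move=> EG nrep; pose n0 := (8 * m + 8)%N.
rewrite (@even_part_quotient m n0) ?euler_theta_2_5 //; first by rewrite /n0; lia.
have ET : eqX m.*2.+1 (euler_theta (6 * n0 + 2) 1) (euler_prod 0 m.*2).
  apply: (@eqX_trans _ (euler_prod 0 n0)); last by apply: euler_prod_trunc; rewrite /n0; lia.
  by apply: eqX_le (@euler_theta_prod n0); rewrite /n0; lia.
apply: eqX_trans (eqX_mul ET (eqX_refl G)) _; apply: eqX_trans EG _.
rewrite -gauss_theta_bin; apply/eqX_sym/eqX_sum_trunc; first by rewrite /n0; lia.
(* An omitted odd [x] is at least [2 * K + 1], so its exponent is at least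
   [5 * 'C(K.+1, 2) >= 5 * K > 2 * m]. *)
set K := (m.*2 %/ 5).+1 => x lex ox.
have : (K * K.+1 * 4 + 1 <= x ^ 2)%N.
  by have : (2 * K + 1 <= x)%N by [lia]; rewrite -(leq_sqr (2 * K + 1)); nia.
have : (2 * K <= K * K.+1)%N by rewrite mulnC leq_mul2l.
by move: (x ^ 2)%N (K * K.+1)%N; rewrite /K; lia.
Qed.

(** * The generating function of the mex-restricted partitions *)

Local Close Scope ring_scope.

Lemma sumn_count n t : all (fun x => 0 < x <= n) t ->
  sumn t = \sum_(i < n) i.+1 * count_mem i.+1 t.
Proof.
elim: t => [|x t IH] /=; first by rewrite big1 // => i _; rewrite muln0.
case/andP => /andP[x0 xn] /IH ->.
under [RHS]eq_bigr do rewrite mulnDr.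
rewrite [RHS]big_split; congr (_ + _).
have lt : x.-1 < n by lia.
rewrite (bigD1 (Ordinal lt)) //= prednK // eqxx muln1 big1 ?addn0 // => i.
rewrite -val_eqE /= => ne; case: eqP => [E|]; last by rewrite muln0.
by move: ne; rewrite E eqxx.
Qed.

Lemma size_leq_sumn t : all (fun x => 0 < x) t -> size t <= sumn t.
Proof. by elim: t => //= x t IH /andP[x0 /IH]; lia. Qed.

(** Encoding partitions by multiplicities turns the generating function into a product over part
    sizes. Counts are at most [n], so [inord] loses nothing. *)
Definition mult n (s : n.-bseq 'I_n.+1) : {ffun 'I_n -> 'I_n.+1} :=
  [ffun i : 'I_n => inord (count_mem i.+1 (map val s))].

Definition weight n (f : {ffun 'I_n -> 'I_n.+1}) := \sum_(i < n) i.+1 * f i.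

Lemma multE n (s : n.-bseq 'I_n.+1) (i : 'I_n) : mult s i = count_mem i.+1 (map val s) :> nat.
Proof.
rewrite ffunE inordK // ltnS; apply: leq_trans (count_size _ _) _.
by rewrite size_map size_bseq.
Qed.

Lemma partition_bounds n (s : n.-bseq 'I_n.+1) : is_partition_of n (map val s) ->
  all (fun x => 0 < x <= n) (map val s).
Proof.
case/and3P => _ /allP pos _; apply/allP => x xs.
rewrite (pos x xs) /=; case/mapP: xs => y _ ->; exact: (ltn_ord y).
Qed.

Lemma mult_inj n :
  {in [pred s : n.-bseq 'I_n.+1 | is_partition_of n (map val s)] &, injective (@mult n)}.
Proof.
move=> s1 s2; rewrite !inE => P1 P2 E.
apply/val_inj/(inj_map val_inj)/(@sorted_eq _ geq) => [x y z /= h1 h2|x y /=||| /=].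
- exact: leq_trans h2 h1.
- by rewrite -eqn_leq => /eqP.
- by case/and3P: P1.
- by case/and3P: P2.
have H x : 0 < x <= n -> count_mem x (map val s1) = count_mem x (map val s2).
  move=> bx; have lt : x.-1 < n by lia.
  have := congr1 (fun f : {ffun 'I_n -> 'I_n.+1} => val (f (Ordinal lt))) E.
  by rewrite /= !multE /= prednK; [|lia].
rewrite /perm_eq; apply/allP => x; rewrite mem_cat => xs /=; apply/eqP/H.
by case/orP: xs; [move/(allP (partition_bounds P1))|move/(allP (partition_bounds P2))].
Qed.

Definition seq_of_mult n (f : {ffun 'I_n -> 'I_n.+1}) :=
  sort geq (flatten [seq nseq (f i) i.+1 | i <- enum 'I_n]).

Lemma count_seq_of_mult n (f : {ffun 'I_n -> 'I_n.+1}) (i : 'I_n) :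
  count_mem i.+1 (seq_of_mult f) = f i.
Proof.
rewrite /seq_of_mult (permP (permEl (perm_sort _ _))) count_flatten -map_comp.
rewrite sumnE big_map big_enum /= (bigD1 i) //= big1 ?addn0.
  by rewrite count_nseq /= eqxx mul1n.
by move=> j ne; rewrite count_nseq /= eqSS val_eqE (negPf ne).
Qed.

Lemma mem_seq_of_mult n (f : {ffun 'I_n -> 'I_n.+1}) x : x \in seq_of_mult f -> 0 < x <= n.
Proof.
rewrite mem_sort => /flattenP[_ /mapP[i _ ->]]; rewrite mem_nseq => /andP[_ /eqP ->].
by rewrite /= ltn_ord.
Qed.

Lemma mult_surj n (f : {ffun 'I_n -> 'I_n.+1}) : weight f = n ->
  exists2 s : n.-bseq 'I_n.+1, is_partition_of n (map val s) & mult s = f.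
Proof.
move=> wf; pose t := seq_of_mult f.
have bt : all (fun x => 0 < x <= n) t by apply/allP => x /mem_seq_of_mult.
have pt : all (fun x => 0 < x) t by apply: sub_all bt => x /andP[].
have st : sumn t = n.
  by rewrite (sumn_count bt) -[RHS]wf; apply: eq_bigr => i _; rewrite count_seq_of_mult.
have zt : size [seq inord x : 'I_n.+1 | x <- t] <= n.
  by rewrite size_map; apply: leq_trans (size_leq_sumn pt) _; rewrite st.
have vt : map val (Bseq zt) = t.
  rewrite /= -map_comp map_id_in // => x /(allP bt) /andP[_ xn].
  by rewrite /= inordK.
exists (Bseq zt).
  by rewrite vt /is_partition_of pt st eqxx !andbT sort_sorted // => x y; apply: leq_total.
apply/ffunP => i; apply/ord_inj.
by rewrite multE vt count_seq_of_mult.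
Qed.

(* [i : 'I_n] stands for the part [i.+1]. *)
Definition contains n k (i : 'I_n) : pred 'I_n.+1 :=
  fun j => (5 %| i.+1) && (i.+1 <= 5 * k) ==> (0 < j).

(* The number of [k] such that 5, 10, ..., 5k are all parts, i.e. mex / 5. *)
Definition mex_index n (f : {ffun 'I_n -> 'I_n.+1}) :=
  \sum_(0 <= k < (n %/ 5).+1) (f \in family (contains k)).

Lemma family_contains n (s : n.-bseq 'I_n.+1) k : k <= n %/ 5 ->
  (mult s \in family (contains k)) = all (fun j => 5 * j \in map val s) (iota 1 k).
Proof.
move=> kn; apply/familyP/allP => [H j|H i].
  rewrite mem_iota => jk; have lt : (5 * j).-1 < n by lia.
  have := H (Ordinal lt); rewrite unfold_in /contains /= prednK; last by lia.
  rewrite dvdn_mulr //= multE /= prednK; last by lia.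
  by rewrite -has_count has_pred1 leq_pmul2l // (_ : j <= k) //; lia.
rewrite unfold_in /contains multE; apply/implyP => /andP[/dvdnP[j Ej] le].
rewrite -has_count has_pred1 Ej mulnC; apply: H; rewrite mem_iota; lia.
Qed.

(** If the mex is [5 * K], the multiples up to [5 * k] are all parts exactly when [k < K], so the
    index is [K]; and [5 * K] is 5 modulo 10 iff [K] is odd. *)
Lemma mex55_index n (s : n.-bseq 'I_n.+1) : is_partition_of n (map val s) ->
  (mex55 (map val s) == 5 %[mod 10]) = odd (mex_index (mult s)).
Proof.
move=> P; rewrite /mex55; case: ex_minnP => m /and3P[m0 /dvdnP[K Em]].
rewrite {m}Em in m0 * => notin min.
have {m0}K0 : 0 < K by lia.
have inK j : 0 < j < K -> j * 5 \in map val s.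
  case/andP => j0 jK; apply: contraT => nin.
  by have := min (j * 5); rewrite nin dvdn_mull // muln_gt0 j0 /= => /(_ isT); lia.
(* The sum defining [mex_index] is long enough, because [5 * (K - 1)] is zero or a part. *)
have leK : K <= (n %/ 5).+1.
  case: K K0 inK {notin min} => [//|[//|K]] _ inK.
  have /(allP (partition_bounds P)) : K.+1 * 5 \in map val s by apply: inK; lia.
  by lia.
have -> : mex_index (mult s) = K.
  rewrite /mex_index (eq_big_nat _ _ (F2 := fun k => (k < K) : nat)); last first.
    move=> k /andP[_ kn]; rewrite family_contains //; congr nat_of_bool.
    apply/allP/idP => [H|kK j].
      rewrite ltnNge; apply/negP => le; move/negP: notin; apply.
      by rewrite mulnC; apply: H; rewrite mem_iota; lia.
    by rewrite mem_iota mulnC => jk; apply: inK; lia.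
  have E N : \sum_(0 <= k < N) (k < K) = minn N K.
    by elim: N => [|N IH]; [rewrite big_geq|rewrite big_nat_recr //= IH]; lia.
  by rewrite E; lia.
lia.
Qed.

Lemma p55_mult n : p55 n = #|[set f : {ffun 'I_n -> 'I_n.+1} |
  (weight f == n) && odd (mex_index f)]|.
Proof.
rewrite /p55 -(card_in_imset (f := @mult n)); last first.
  by move=> s1 s2; rewrite !inE => /andP[P1 _] /andP[P2 _]; apply: mult_inj.
apply: eq_card => f; apply/imsetP/idP => [[s]|].
  rewrite !inE => /andP[P]; rewrite mex55_index // => O ->; rewrite O andbT.
  case/and3P: (P) => _ _ /eqP Es; apply/eqP.
  rewrite -[RHS]Es (sumn_count (partition_bounds P)).
  by apply: eq_bigr => i _; rewrite multE.
rewrite !inE => /andP[/eqP /mult_surj[s P <-] O].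
by exists s => //; rewrite inE P mex55_index.
Qed.

Local Open Scope ring_scope.

Definition mex_poly n : {poly 'F_2} :=
  \sum_(0 <= k < (n %/ 5).+1)
    \prod_(i < n) \sum_(j < n.+1 | contains k i j) 'X^(i.+1 * j).

(** Expanding the products and exchanging sums gives each multiplicity function of weight [n] the
    coefficient [mex_index f], which in ['F_2] is the indicator of its oddness. *)
Lemma mex_poly_coef n : (mex_poly n)`_n = (p55 n)%:R.
Proof.
rewrite /mex_poly coef_sum p55_mult -sum1_card natr_sum.
transitivity (\sum_(f : {ffun 'I_n -> 'I_n.+1} | weight f == n)
  (mex_index f)%:R : 'F_2); last first.
  rewrite [RHS](eq_bigl (fun f : {ffun 'I_n -> 'I_n.+1} =>
    (weight f == n) && odd (mex_index f))); last first.
    by move=> f; rewrite inE.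
  rewrite big_mkcondr; apply: eq_bigr => f _; rewrite natr_F2; by case: odd.
under eq_bigr do rewrite bigA_distr_big_dep coef_sum.
rewrite /mex_index; under [RHS]eq_bigr do rewrite natr_sum.
rewrite [RHS]exchange_big /=; apply: eq_bigr => k _.
rewrite big_mkcond [RHS]big_mkcond; apply: eq_bigr => f _.
rewrite -(big_morph _ (fun a b => exprD 'X a b) (expr0 'X)) coefXn -/(weight f) eq_sym.
by case: (f \in _); case: eqP.
Qed.

Lemma mul_geometric (y : {poly 'F_2}) N : (1 + y) * (\sum_(j < N) y ^+ j) = 1 + y ^+ N.
Proof.
elim: N => [|N IH]; first by rewrite big_ord0 mulr0 expr0 addF2_poly.
rewrite big_ord_recr /= mulrDr IH mulrDl mul1r -exprS.
by rewrite addrA -(addrA 1) addF2_poly addr0.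
Qed.

Lemma mul_geometric_pos (y : {poly 'F_2}) N :
  (1 + y) * (\sum_(j < N.+1 | (0 < j)%N) y ^+ j) = y + y ^+ N.+1.
Proof.
have := mul_geometric y N.+1; rewrite (bigD1 ord0) //= expr0 mulrDr mulr1.
rewrite (eq_bigl (fun j : 'I_N.+1 => (0 < j)%N)); last by move=> j; rewrite lt0n.
move=> /(congr1 (+%R (1 + y))); rewrite addrA addF2_poly add0r => ->.
by rewrite addrACA addF2_poly add0r.
Qed.

Lemma sum_mult5 n k : (5 * k <= n)%N ->
  (\sum_(i < n) (if (5 %| i.+1) && (i.+1 <= 5 * k) then i.+1 else 0) = 5 * 'C(k.+1, 2))%N.
Proof.
move=> le; rewrite -(big_mkord xpredT
  (fun i => if (5 %| i.+1) && (i.+1 <= 5 * k) then i.+1 else 0)%N).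
rewrite (big_cat_nat (leq0n _) le) //= [X in (_ + X)%N]big_nat_cond.
rewrite [X in (_ + X)%N]big1 ?addn0; last by move=> i; case: ifP; lia.
rewrite (eq_big_nat _ _ (F2 := fun i => if (5 %| i.+1) then i.+1 else 0)%N); last first.
  by move=> i /andP[_ lt]; rewrite lt andbT.
elim: k {le} => [|k IH]; first by rewrite big_geq.
rewrite (_ : 5 * k.+1 = (5 * k).+4.+1)%N; last by lia.
rewrite !(big_nat_recr _ _ _ (leq0n _)) /= IH (binS k.+1) bin1.
do 4!(rewrite ifF; last by lia); rewrite ifT; lia.
Qed.

(** Each Euler factor collapses its geometric sum modulo [X^(n+1)]: to 1 for a free part, and to
    ['X^(i.+1)] for a required one. The required parts 5, 10, ..., 5k add up to
    [5 * 'C(k.+1, 2)]. *)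
Lemma euler_prod_mul_mex_poly n : eqX n.+1 (euler_prod 0 n * mex_poly n)
  (\sum_(0 <= k < (n %/ 5).+1) 'X^(5 * 'C(k.+1, 2))).
Proof.
rewrite /mex_poly mulr_sumr => i lti; rewrite !coef_sum.
apply: eq_big_nat => k /andP[_ kn]; move: i lti; rewrite -/(eqX _ _ _).
rewrite -(@sum_mult5 n); last by lia.
rewrite (big_morph _ (fun a b => exprD 'X a b) (expr0 'X)) /euler_prod big_mkord -big_split /=.
apply: eqX_prod => i.
rewrite (eq_bigr (fun j : 'I_n.+1 => ('X^(i.+1) : {poly 'F_2}) ^+ j)); last first.
  by move=> j _; rewrite exprM.
have le : (n.+1 <= i.+1 * n.+1)%N by rewrite leq_pmull.
case: ifP => H.
  rewrite (eq_bigl (fun j : 'I_n.+1 => (0 < j)%N)); last by move=> j; rewrite /contains H.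
  by rewrite mul_geometric_pos -exprM -['X^(_ * _)]mul1r; apply: eqX_addXn.
rewrite (eq_bigl xpredT); last by move=> j; rewrite /contains H.
by rewrite mul_geometric -exprM -['X^(_ * _)]mul1r; apply: eqX_addXn.
Qed.

Local Close Scope ring_scope.

Lemma p55_even m : (forall x y, 2 * x ^ 2 + 5 * y ^ 2 != 24 * m + 7) -> ~~ odd (p55 m.*2).
Proof.
move=> nrep; rewrite -natr_F2_eq0 -mex_poly_coef; apply/eqP.
by apply: even_quotient_euler_prod nrep; apply: euler_prod_mul_mex_poly.
Qed.

(** * The quadratic form 2x^2 + 5y^2 *)

Lemma legendreN1P (a : int) p : legendre a p = (-1)%Z ->
  forall x : nat, 0 < p -> ~~ (p%:Z %| (x%:Z ^+ 2 - a)%R)%Z.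
Proof.
rewrite /legendre; case: ifP => // _; case: ifP => // /existsPn H _ x p0.
have lt : x %% p < p by rewrite ltn_mod.
apply: contra (H (Ordinal lt)) => /= dv; rewrite eqz_mod_dvd.
have -> : ((x %% p)%N%:Z ^+ 2 - a = (x%:Z ^+ 2 - a)
    - (x %/ p)%N%:Z * (x + x %% p)%N%:Z * p%:Z)%R.
  by have := divn_eq x p; set u := x %/ p; set v := x %% p => Ex; rewrite Ex !PoszD !PoszM; ring.
by rewrite rpredB // dvdz_mull.
Qed.

Lemma anisotropic p x y : prime p -> 5 <= p -> legendre (-10)%Z p = (-1)%Z ->
  p %| 2 * x ^ 2 + 5 * y ^ 2 -> p %| x /\ p %| y.
Proof.
move=> pr p5 leg dv.
have p2 : ~~ (p %| 2) by rewrite gtnNdvd //; lia.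
have py : p %| y.
  apply: contraT => npy; have cyp : coprime y p by rewrite coprime_sym prime_coprime.
  (* A multiple of [y] that is 1 modulo [p]; the cofactor [u] inverts [y]. *)
  have /dvdnP[u Eu] : y %| chinese y p 0 1.
    by have := chinese_modl cyp 0 1; rewrite mod0n => /eqP.
  have Eu1 : u * y = 1 %[mod p] by rewrite -Eu chinese_modr.
  (* Multiplying the form by [2 * u ^ 2] shows that [(2 * x * u) ^ 2] is -10 modulo [p]. *)
  have /negP[] := legendreN1P leg (2 * x * u) (prime_gt0 pr).
  have -> : ((2 * x * u)%N%:Z ^+ 2 - (-10)%Z = (2 * u ^ 2 * (2 * x ^ 2 + 5 * y ^ 2))%N%:Z
     - 10 * (u * y + 1)%N%:Z * ((u * y)%N%:Z - 1))%R.
    by rewrite !(PoszM, PoszD, expnS, expn0); ring.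
  rewrite rpredB //; first by rewrite dvdzE !absz_nat dvdn_mull.
  by rewrite dvdz_mull // -eqz_mod_dvd !modz_nat Eu1.
split=> //; move: dv; rewrite dvdn_addl; last by rewrite dvdn_mull // dvdn_exp.
by rewrite Euclid_dvdM // (negPf p2) /= Euclid_dvdX // andbT.
Qed.

(** Descent: anisotropy lets [p] be divided out of [x] and [y], which lowers the exponent by 2; at
    exponent 1 it would force [p %| c]. *)
Lemma no_repr_odd_valuation p k c x y : prime p -> 5 <= p ->
  legendre (-10)%Z p = (-1)%Z -> ~~ (p %| c) ->
  2 * x ^ 2 + 5 * y ^ 2 <> p ^ (2 * k + 1) * c.
Proof.
move=> pr p5 leg npc; elim: k x y => [|k IH] x y E.
  all: have [/dvdnP[x' Ex] /dvdnP[y' Ey]] : p %| x /\ p %| y.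
  1,3: by apply: anisotropic => //; rewrite E dvdn_mulr // dvdn_exp // addn1.
  all: have E2 : 2 * x ^ 2 + 5 * y ^ 2 = p ^ 2 * (2 * x' ^ 2 + 5 * y' ^ 2).
  1,3: by rewrite Ex Ey !expnMn; ring.
  move/negP: npc; apply; apply/dvdnP; exists (2 * x' ^ 2 + 5 * y' ^ 2).
  apply/eqP; rewrite -(eqn_pmul2l (prime_gt0 pr)); apply/eqP.
  by rewrite -[p in LHS]expn1 -E E2; ring.
apply: (IH x' y'); apply/eqP; rewrite -(eqn_pmul2l (_ : 0 < p ^ 2)); last first.
  by rewrite expn_gt0 prime_gt0.
by rewrite -E2 E mulnA -expnD; apply/eqP; congr (p ^ _ * _); lia.
Qed.

Theorem theorem3p8 (p j alpha n : nat) (p_ge5 : 5 <= p) (p_prime : prime p)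
    (p_legendre : legendre (-10)%Z p = (-1)%Z) (j_range : 1 <= j <= p - 1) :
  p55 (2 * p ^ (2 * alpha + 1) * (p * n + j)
       + 7 * ((p ^ (2 * alpha + 2) - 1) %/ 12)) = 0 %[mod 2].
Proof.
have p23 d : 0 < d < 5 -> ~~ (p %| d) by move=> hd; rewrite gtnNdvd //; lia.
have cp : coprime (p ^ alpha.+1) 6.
  rewrite coprimeXl // prime_coprime // (_ : 6 = 2 * 3) // Euclid_dvdM //.
  by rewrite negb_or !p23.
(* The power is the square of a number prime to 6, so the quotient by 12 in the statement is
   [2 * w]. *)
have [w Ew] : exists w, p ^ (2 * alpha + 2) = 24 * w + 1.
  exists (p ^ (2 * alpha + 2) %/ 24); have := sqr_mod24 cp.
  by rewrite -expnM (_ : alpha.+1 * 2 = 2 * alpha + 2); lia.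
have Ep : p ^ (2 * alpha + 2) = p ^ (2 * alpha + 1) * p by rewrite -expnSr; congr expn; lia.
set q := p ^ (2 * alpha + 1) in Ep *.
pose m := q * (p * n + j) + 7 * w.
have -> : 2 * q * (p * n + j) + 7 * ((p ^ (2 * alpha + 2) - 1) %/ 12) = m.*2.
  by rewrite Ew addnK (_ : 24 * w = 2 * w * 12) ?mulnK // /m; lia.
have nrep x y : 2 * x ^ 2 + 5 * y ^ 2 != 24 * m + 7.
  (* Since [24 * w + 1 = q * p], the number [24 * m + 7] equals [q * (24 * (p * n + j) + 7 * p)],
     whose second factor is [24 * j] modulo [p], hence nonzero. *)
  apply/eqP => E; apply: (@no_repr_odd_valuation p alpha (24 * (p * n + j) + 7 * p) x y) => //.
    rewrite dvdn_addl; last exact: dvdn_mull.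
    rewrite mulnDr dvdn_addr; last by rewrite mulnCA dvdn_mulr.
    rewrite (_ : 24 = 2 * 3 * 4) // !Euclid_dvdM // !negb_or (p23 2) // (p23 3) // (p23 4) //=.
    by rewrite gtnNdvd //; lia.
  by rewrite E -/q /m; move: Ep; rewrite Ew; lia.
by have := p55_even nrep; lia.
Qed.
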